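(* For $i \in \{1,2\}$, the maximum $i$-level cut of the (unreduced) output of Apply of $f$ and $g$ is at most $C_{i:f} \cdot C_{i:g}$.
   Context: A Binary Decision Diagram (BDD) $f$ is an ordered (w.r.t. the identity variable ordering) DAG $(V,A)$ with a single root, terminal sinks in $\{\bot,\top\}$, and internal nodes $v$ each labelled by a variable index $\mathit{label}(v)$ and having exactly two outgoing arcs (low and high). A levelisation of a DAG $(V,A)$ is a function $\mathcal{L} : V \to \mathbb{N}\cup\{\infty\}$ with $\mathcal{L}(v) < \mathcal{L}(v')$ whenever $v \to v' \in A$. For BDDs the levelisation used is $\mathcal{L}_{\mathrm{BDD}}(v) = \mathit{label}(v)$ if $v$ is an internal node and $\mathcal{L}_{\mathrm{BDD}}(v) = \infty$ if $v$ is a terminal. A cut $(S,T)$ of $(V,A)$ is a partition of $V$; its (unweighted) size is the number of arcs from $S$ to $T$. An $i$-level cut (for $i \geq 1$) is a cut $(S,T)$ for which there exists $j \in \mathbb{N}$ with $\mathcal{L}(s) < j+i$ for all $s \in S$ and $\mathcal{L}(t) > j$ for all $t \in T$. $C_{i:f}$ denotes the size of the unweighted maximum $i$-level cut (w.r.t. $\mathcal{L}_{\mathrm{BDD}}$) of the DAG of $f$, where an extra arc $(-\infty) \to r_f$ into the root $r_f$ is added so every node has at least one incoming arc. Apply, given BDDs $f,g$ and a binary Boolean operator $\odot$, computes $f \odot g$ by a product construction starting from the pair of roots $(r_f,r_g)$: pairs of terminals $(b_f,b_g)$ yield terminal $b_f \odot b_g$; otherwise a pair $(v_f,v_g)$ yields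 a node with label $\ell = \min(\mathit{label}(v_f),\mathit{label}(v_g))$ whose low (resp. high) child is the pair obtained by replacing each component whose label equals $\ell$ by its low (resp. high) child and keeping the other component unchanged. The output of this product construction, before applying the BDD reduction rules, is the unreduced output. *)

(* Defs.v *)
From HB Require Import structures.
From mathcomp Require Import all_boot.
From mathcomp Require Import boolp.
Set Implicit Arguments.
Unset Strict Implicit.
Unset Printing Implicit Defensive.

Inductive level := MinusInfty | Level of nat | PlusInfty.

Definition level_lt (x y : level) : bool :=
  match x, y with
  | MinusInfty, MinusInfty => false
  | MinusInfty, _ => true
  | Level m, Level n => m < n
  | Level _, PlusInfty => true
  | _, _ => false
  end.

(* A finite directed multigraph together with a levelisation, whose existence
   makes the graph acyclic.  Arcs have an identity of their own, so parallel
   arcs are counted separately. *)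
Record levelled_dag := LevelledDag {
  carrier : finType;
  vertices : {set carrier};
  arc : finType;
  source : arc -> carrier;
  target : arc -> carrier;
  dag_level : carrier -> level;
  source_in : forall a, source a \in vertices;
  target_in : forall a, target a \in vertices;
  levelisation : forall a, level_lt (dag_level (source a)) (dag_level (target a))
}.

Section Cuts.
Variable G : levelled_dag.
Implicit Types S T : {set carrier G}.

Definition is_cut S T : Prop := S :|: T = vertices G /\ [disjoint S & T].

Definition cut_size S T : nat :=
  #|[set a : arc G | (source a \in S) && (target a \in T)]|.

Definition is_level_cut (i : nat) S T : Prop :=
  is_cut S T /\
  exists j : nat,
    (forall s, s \in S -> level_lt (dag_level s) (Level (j + i))) /\
    (forall t, t \in T -> level_lt (Level j) (dag_level t)).

(* The empty maximum is 0; for i >= 1 and the graphs of BDDs this case does not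
   arise, see [bdd_level_cut_exists]. *)
Definition max_level_cut (i : nat) : nat :=
  \max_(c : {set carrier G} * {set carrier G} | `[< is_level_cut i c.1 c.2 >])
     cut_size c.1 c.2.

End Cuts.

(* Nodes are [inl v] for an internal node v and [inr b] for a terminal, with
   [inr true] standing for top and [inr false] for bottom. *)
Record bdd_data := BddData {
  internal : finType;
  label : internal -> nat;
  low : internal -> internal + bool;
  high : internal -> internal + bool;
  root : internal + bool
}.

Definition node (f : bdd_data) : finType := (internal f + bool)%type.

Definition child (f : bdd_data) (b : bool) (v : internal f) : node f :=
  if b then high v else low v.

Definition bdd_level (f : bdd_data) (x : node f) : level :=
  if x is inl v then Level (label v) else PlusInfty.

Definition child_rel (f : bdd_data) : rel (node f) :=
  fun x y => if x is inl v then (y == low v) || (y == high v) else false.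

Record bdd := Bdd {
  bdd_of :> bdd_data;
  bdd_ordered : forall b (v : internal bdd_of),
    level_lt (bdd_level (inl v : node bdd_of)) (bdd_level (child b v));
  bdd_rooted : forall v : internal bdd_of,
    connect (@child_rel bdd_of) (root bdd_of) (inl v)
}.

Section BddDag.
Variable f : bdd.

(* [None] is the additional source vertex (-oo); a terminal is a vertex of the
   graph only if it is reachable. *)
Definition bdd_vertices : {set option (node f)} :=
  [set x | if x is Some y then connect (@child_rel f) (root f) y else true].

(* [None] is the additional arc (-oo) -> root, and [Some (v, b)] is the low
   (b = false) or high (b = true) arc out of v. *)
Definition bdd_arc : finType := option (internal f * bool).

Definition bdd_source (a : bdd_arc) : option (node f) :=
  if a is Some (v, _) then Some (inl v) else None.

Definition bdd_target (a : bdd_arc) : option (node f) :=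
  if a is Some (v, b) then Some (child b v) else Some (root f).

Definition bdd_dag_level (x : option (node f)) : level :=
  if x is Some y then bdd_level y else MinusInfty.

Lemma bdd_source_in a : bdd_source a \in bdd_vertices.
Proof. by case: a => [[v b]|]; rewrite inE //= bdd_rooted. Qed.

Lemma bdd_target_in a : bdd_target a \in bdd_vertices.
Proof.
case: a => [[v b]|]; rewrite inE //=.
apply: connect_trans (bdd_rooted v) (connect1 _).
by rewrite /= /child; case: b; rewrite eqxx ?orbT.
Qed.

Lemma bdd_levelisation a :
  level_lt (bdd_dag_level (bdd_source a)) (bdd_dag_level (bdd_target a)).
Proof.
case: a => [[v b]|] /=; first exact: bdd_ordered.
by case: (root f).
Qed.

Definition bdd_dag : levelled_dag :=
  LevelledDag bdd_source_in bdd_target_in bdd_levelisation.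

End BddDag.

Lemma bdd_level_cut_exists (f : bdd) (i : nat) :
  0 < i -> exists S T, is_level_cut (G := bdd_dag f) i S T.
Proof.
move=> i0.
pose A := [set x : carrier (bdd_dag f) | level_lt (dag_level x) (Level 1)].
exists (vertices (bdd_dag f) :&: A), (vertices (bdd_dag f) :\: A); split.
  split; first exact: setID.
  by rewrite -setI_eq0; apply/eqP/setP=> x; rewrite !inE; case: level_lt;
    rewrite ?andbF.
exists 0; split=> x; rewrite !inE.
  case/andP=> _; case: (dag_level x) => //= n n1.
  exact: leq_trans n1 i0.
by case/andP=> + _; case: (dag_level x) => //= n; rewrite ltnS -ltnNge.
Qed.

Definition max_bdd_cut (i : nat) (f : bdd) : nat := max_level_cut (bdd_dag f) i.

Section Apply.
Variables (op : bool -> bool -> bool) (f g : bdd).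

Definition apply_pair : finType := (node f * node g)%type.

Definition apply_root : apply_pair := (root f, root g).

Definition apply_terminal (p : apply_pair) : option bool :=
  if p is (inr bf, inr bg) then Some (op bf bg) else None.

(* The value on a pair of terminals is irrelevant. *)
Definition apply_label (p : apply_pair) : nat :=
  match p with
  | (inl u, inl v) => minn (label u) (label v)
  | (inl u, inr _) => label u
  | (inr _, inl v) => label v
  | (inr _, inr _) => 0
  end.

Definition descend (h : bdd_data) (l : nat) (b : bool) (x : node h) : node h :=
  if x is inl v then if label v == l then child b v else x else x.

Definition apply_child (b : bool) (p : apply_pair) : apply_pair :=
  (descend (apply_label p) b p.1, descend (apply_label p) b p.2).

Definition apply_rel : rel apply_pair :=
  fun p q => (q == apply_child false p) || (q == apply_child true p).

Definition apply_internal : finType :=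
  {p : apply_pair |
     connect apply_rel apply_root p && (apply_terminal p == None)}.

(* Only used on reachable pairs, for which [insub] fails exactly on the pairs of
   terminals; the default value of [odflt] is then never used. *)
Definition apply_node (p : apply_pair) : apply_internal + bool :=
  if insub p is Some q then inl q else inr (odflt false (apply_terminal p)).

Definition apply_data : bdd_data := {|
  internal := apply_internal;
  label := fun q => apply_label (val q);
  low := fun q => apply_node (apply_child false (val q));
  high := fun q => apply_node (apply_child true (val q));
  root := apply_node apply_root
|}.

Lemma descend_label (h : bdd) l b (x : node h) :
  (forall v, x = inl v -> l <= label v) ->
  forall w, descend l b x = inl w -> l < label w.
Proof.
case: x => [v|c] //= /(_ v erefl) lv w.
have [e|ne] := eqVneq (label v) l => [cw|[<-]].
  by have := bdd_ordered b v; rewrite cw /= e.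
by rewrite ltn_neqAle eq_sym ne.
Qed.

Lemma apply_ordered b (q : internal apply_data) :
  level_lt (bdd_level (inl q : node apply_data)) (bdd_level (child b q)).
Proof.
have -> : child b q = apply_node (apply_child b (val q)) by case: b.
rewrite /apply_node; case: insubP => [r /andP[_ tr] er|//].
change (apply_label (val q) < apply_label (val r)).
move: (val q) tr er => {q} p tr er.
have lt1 w : (apply_child b p).1 = inl w -> apply_label p < label w.
  apply: descend_label => v; case: p {er tr} => [[u|?] [?|?]] //= [<-] //.
  exact: geq_minl.
have lt2 w : (apply_child b p).2 = inl w -> apply_label p < label w.
  apply: descend_label => v; case: p {er tr lt1} => [[?|?] [u|?]] //= [<-] //.
  exact: geq_minr.
rewrite er; move/eqP: tr lt1 lt2.
case: (apply_child b p) => [[u|?] [v|?]] //= _ h1 h2.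
- by rewrite leq_min h1 ?h2.
- exact: h1.
- exact: h2.
Qed.

Lemma apply_rooted (q : internal apply_data) :
  connect (@child_rel apply_data) (root apply_data) (inl q).
Proof.
suff reach p : connect apply_rel apply_root p ->
    connect (@child_rel apply_data) (apply_node apply_root) (apply_node p).
  have /andP[/reach] := valP q.
  by rewrite {2}/apply_node valK.
case/connectP=> s; elim/last_ind: s p => [|s r IH] p /=; first by move=> _ ->.
rewrite rcons_path last_rcons => /andP[ps sr] ->{p}.
have := IH _ ps erefl; set p := last _ _ in sr * => cp.
have rp : connect apply_rel apply_root p by apply/connectP; exists s.
case tp : (apply_terminal p) => [c|].
  suff -> : r = p by [].
  move: sr tp; rewrite /apply_rel /apply_child.
  by case: p {cp rp} => [[?|?] [?|?]] //= /orP[] /eqP ->.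
apply: connect_trans cp (connect1 _).
have ip : connect apply_rel apply_root p && (apply_terminal p == None).
  by rewrite rp tp.
have -> : apply_node p = inl (Sub p ip) by rewrite /apply_node insubT.
by rewrite /=; case/orP: sr => /eqP ->; rewrite eqxx ?orbT.
Qed.

Definition apply : bdd := Bdd apply_ordered apply_rooted.

End Apply.

(* Main.v *)
(** Fix [j] and call the nodes with level strictly between [j] and [j + i] the
    band; for [i <= 2] no arc joins two of them.  A crossing arc of a level cut
    is charged to its target if it starts at a level at most [j], and otherwise
    to its source, which lies in the band.  If [d x] arcs enter [x] from levels
    at most [j], the best cut charges [w x = d x] arcs to a node beyond the band
    and [w x = max (d x) 2] arcs to a node of the band, so the maximum cut for
    this [j] is the sum of the weights [w x].

    In the product, each arc determines a pair of arcs of [f] and [g]: a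
    component that descends contributes the arc it follows, the other one an arc
    by which it was entered earlier.  The higher source level among the two
    identifies the product arc, so this map is injective and
    [d (x, y) <= d x * d y].  As [d x] and [d y] are positive for a reachable
    band pair [(x, y)], also [max (d (x, y)) 2 <= w x * w y], and summing over
    all pairs gives the product of the two sums. *)

Require Import Defs.
From mathcomp Require Import all_boot.
From mathcomp Require Import boolp.

Set Implicit Arguments.
Unset Strict Implicit.
Unset Printing Implicit Defensive.

(** * Minima and order of levels *)

Definition level_min (x y : level) : level := if level_lt x y then x else y.

Lemma level_lt_trans y x z : level_lt x y -> level_lt y z -> level_lt x z.
Proof. by case: x y z => [|m|] [|n|] [|k|] //=; apply: ltn_trans. Qed.

Lemma level_ltxx x : level_lt x x = false.
Proof. by case: x => //= n; rewrite ltnn. Qed.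

Lemma level_lt_min x y z :
  level_lt x (level_min y z) = level_lt x y && level_lt x z.
Proof.
rewrite /level_min; case: x y z => [|m|] [|n|] [|k|] //=; rewrite ?andbT ?andbF //.
all: try by case: (n < k).
by have := leq_min m.+1 n k; rewrite /minn; case: (n < k).
Qed.

Lemma level_min_lt x y z :
  level_lt (level_min x y) z = level_lt x z || level_lt y z.
Proof.
rewrite /level_min; case: x y z => [|m|] [|n|] [|k|] //=; rewrite ?orbT ?orbF //.
all: try by case: (m < n).
by have := gtn_min k m n; rewrite /minn; case: (m < n).
Qed.

Lemma level_ltS x j : level_lt x (Level j.+1) = ~~ level_lt (Level j) x.
Proof. by case: x => //= n; rewrite ltnS -leqNgt. Qed.

(** * Arcs entering a node, and the factors of a product arc *)

Section EnteringArcs.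
Variable h : bdd.
Implicit Types (x : node h) (a : bdd_arc h) (l m : level).

Definition source_level a : level := bdd_dag_level (bdd_source a).

Definition enters l x : pred (bdd_arc h) :=
  fun a => (bdd_target a == Some x) && level_lt (source_level a) l.

Definition at_label (n : nat) x : bool :=
  if x is inl v then label v == n else false.

(* The arc of [h] contributing to the product arc that leaves a pair with label
   [n] and component [x]: the arc out of [x] if that component descends,
   otherwise an arc by which [x] was entered earlier. *)
Definition factor (n : nat) (b : bool) x : bdd_arc h :=
  let entry := odflt None [pick a | enters (Level n) x a] in
  if x is inl v then if label v == n then Some (v, b) else entry else entry.

Lemma at_label_level n x : at_label n x -> bdd_level x = Level n.
Proof. by case: x => //= v /eqP ->. Qed.

Lemma factor_at n b x : at_label n x ->
  exists2 v, x = inl v & factor n b x = Some (v, b).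
Proof. by case: x => //= v e; exists v => //; rewrite e. Qed.

Lemma source_level_factor_at n b x :
  at_label n x -> source_level (factor n b x) = Level n.
Proof.
by move=> e; have [v ev ->] := factor_at b e; rewrite -(at_label_level e) ev.
Qed.

Lemma descend_at n b x v : x = inl v -> at_label n x -> descend n b x = child b v.
Proof. by move=> -> /= ->. Qed.

Lemma descend_not_at n b x : ~~ at_label n x -> descend n b x = x.
Proof. by case: x => //= v /negbTE ->. Qed.

(** The entry hypothesis makes the [pick] succeed, so the default [None] in [factor] never
    surfaces. *)
Lemma factor_not_at n b x : (exists a, enters (Level n) x a) ->
  ~~ at_label n x -> enters (Level n) x (factor n b x).
Proof.
move=> [a ea] nx.
have -> : factor n b x = odflt None [pick a | enters (Level n) x a].
  by case: x {ea} nx => //= v /negbTE ->.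
by case: pickP => [//|/(_ a)]; rewrite ea.
Qed.

Lemma target_factor n b x : (exists a, enters (Level n) x a) ->
  bdd_target (factor n b x) = Some (descend n b x).
Proof.
move=> ex; have [atx|nx] := boolP (at_label n x).
  by have [v ev ->] := factor_at b atx; rewrite (descend_at b ev atx).
by rewrite (descend_not_at b nx); have /andP[/eqP] := factor_not_at b ex nx.
Qed.

Lemma source_level_factor n b x m : (exists a, enters (Level n) x a) ->
  level_lt (Level n) m -> level_lt (source_level (factor n b x)) m.
Proof.
move=> ex nm; have [atx|nx] := boolP (at_label n x).
  by rewrite source_level_factor_at.
by have /andP[_ /level_lt_trans] := factor_not_at b ex nx; apply.
Qed.

(** A component at label [n] yields a factor starting exactly at level [n], any other component one
    starting strictly before, so equal factors are of the same kind. The common source or the common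
    target then determines the component; only the first kind remembers the branch. *)
Lemma factor_inj n b b' x x' :
  (exists a, enters (Level n) x a) -> (exists a, enters (Level n) x' a) ->
  factor n b x = factor n b' x' -> x = x' /\ (at_label n x -> b = b').
Proof.
have ltnn_level : level_lt (Level n) (Level n) = false by rewrite /= ltnn.
move=> ex ex'.
have [atx|nx] := boolP (at_label n x); have [atx'|nx'] := boolP (at_label n x').
- have [v -> ->] := factor_at b atx; have [v' -> ->] := factor_at b' atx'.
  by case=> -> ->.
- move=> e; have /andP[_] := factor_not_at b' ex' nx'.
  by rewrite -e source_level_factor_at // ltnn_level.
- move=> e; have /andP[_] := factor_not_at b ex nx.
  by rewrite e source_level_factor_at // ltnn_level.
- move=> e; have /andP[/eqP] := factor_not_at b ex nx.
  have /andP[/eqP + _] := factor_not_at b' ex' nx'.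
  by rewrite e => -> [->].
Qed.

Lemma level_descend n b x : level_lt (bdd_level x) (Level n) = false ->
  level_lt (Level n) (bdd_level (descend n b x)).
Proof.
move=> nx; have := @descend_label h n b x.
case: (descend n b x) => //= w; apply=> // v xv.
by move: nx; rewrite xv /= ltnNge => /negbFE.
Qed.

End EnteringArcs.

(** * Product arcs as pairs of arcs *)

Section ApplyArcs.
Variables (op : bool -> bool -> bool) (f g : bdd).
Implicit Types (p : apply_pair f g) (e : bdd_arc (apply op f g)).

(** Unlike [apply_label], this places pairs of terminals at [PlusInfty]. *)
Definition pair_level p : level := level_min (bdd_level p.1) (bdd_level p.2).

Definition reachable p : bool := connect (@apply_rel f g) (apply_root f g) p.

Lemma pair_level_label p :
  apply_terminal op p = None -> pair_level p = Level (apply_label p).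
Proof.
case: p => [[u|c] [v|d]] //= _; rewrite /pair_level /level_min //=.
by rewrite /minn; case: (label u < label v).
Qed.

Lemma level_apply_node p : reachable p ->
  bdd_level (f := apply op f g) (apply_node op p) = pair_level p.
Proof.
move=> rp; rewrite /apply_node; case: insubP => [q /andP[_ /eqP tq] eq|].
  by rewrite pair_level_label //= eq.
by rewrite [connect _ _ _]rp /=; case: p {rp} => [[u|c] [v|d]].
Qed.

Lemma label_le_components p : apply_terminal op p = None ->
  level_lt (bdd_level p.1) (Level (apply_label p)) = false /\
  level_lt (bdd_level p.2) (Level (apply_label p)) = false.
Proof.
by move=> /pair_level_label <-; rewrite !level_lt_min !level_ltxx andbF.
Qed.

Lemma pair_level_child b p : apply_terminal op p = None ->
  level_lt (Level (apply_label p)) (pair_level (apply_child b p)).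
Proof.
move=> /label_le_components[l1 l2].
by rewrite level_lt_min !level_descend.
Qed.

Lemma reachable_child b p : reachable p -> reachable (apply_child b p).
Proof.
move=> rp; apply: connect_trans rp (connect1 _).
by rewrite /apply_rel; case: b; rewrite eqxx ?orbT.
Qed.

(** Induction along a path from the root pair, whose components are entered by the additional arcs:
    the factors of the last step enter the components of its target. *)
Lemma reachable_entered p : reachable p ->
  (exists a, enters (pair_level p) p.1 a) /\ (exists a, enters (pair_level p) p.2 a).
Proof.
case/connectP=> s; elim/last_ind: s p => [|s r IH] p /=.
  move=> _ ->; split; exists None; rewrite /enters eqxx /pair_level level_lt_min /=;
  by case: (Defs.root f) (Defs.root g) => [?|?] [?|?].
rewrite rcons_path last_rcons => /andP[ps sr] ->{p}.
have := IH _ ps erefl; move: (last _ _) sr => p /= pr.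
have [b ->] : exists b, r = apply_child b p.
  by case/orP: pr => /eqP ->; [exists false|exists true].
(* [apply_rel] loops on a pair of terminals, so there the path has not moved. *)
case tp: (apply_terminal op p) => [c|].
  by case: p tp {pr} => [[u|?] [v|?]].
rewrite (pair_level_label tp) => -[e1 e2].
have lt_child := pair_level_child b tp.
split; [exists (factor (apply_label p) b p.1) | exists (factor (apply_label p) b p.2)];
  by rewrite /enters target_factor // eqxx source_level_factor.
Qed.

(** The target as a pair, before [apply_node] merges pairs of terminals. *)
Definition arc_pair e : apply_pair f g :=
  if e is Some (q, b) then apply_child b (val q) else apply_root f g.

Definition left_factor e : bdd_arc f :=
  if e is Some (q, b) then factor (apply_label (val q)) b (val q).1 else None.

Definition right_factor e : bdd_arc g :=
  if e is Some (q, b) then factor (apply_label (val q)) b (val q).2 else None.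

Lemma internal_terminal (q : internal (apply op f g)) :
  apply_terminal op (val q) = None.
Proof. by have /andP[_ /eqP] := valP q. Qed.

Lemma internal_reachable (q : internal (apply op f g)) : reachable (val q).
Proof. by have /andP[] := valP q. Qed.

Lemma internal_entered (q : internal (apply op f g)) :
  (exists a, enters (Level (apply_label (val q))) (val q).1 a) /\
  (exists a, enters (Level (apply_label (val q))) (val q).2 a).
Proof.
rewrite -(pair_level_label (internal_terminal q)).
exact: reachable_entered (internal_reachable q).
Qed.

Lemma arc_pair_reachable e : reachable (arc_pair e).
Proof.
case: e => [[q b]|]; last exact: connect0.
exact: reachable_child (internal_reachable q).
Qed.

Lemma target_arc_pair e : bdd_target e = Some (apply_node op (arc_pair e)).
Proof. by case: e => [[q []]|]. Qed.

Lemma target_factors e :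
  bdd_target (left_factor e) = Some (arc_pair e).1 /\
  bdd_target (right_factor e) = Some (arc_pair e).2.
Proof.
case: e => [[q b]|] //=; have [e1 e2] := internal_entered q.
by rewrite !target_factor.
Qed.

Lemma source_level_factors m e : level_lt (source_level e) m ->
  level_lt (source_level (left_factor e)) m /\
  level_lt (source_level (right_factor e)) m.
Proof.
case: e => [[q b]|] //= lm; have [e1 e2] := internal_entered q.
by rewrite !source_level_factor.
Qed.

Lemma at_apply_label p : apply_terminal op p = None ->
  at_label (apply_label p) p.1 || at_label (apply_label p) p.2.
Proof.
case: p => [[u|c] [v|d]] //= _; rewrite ?eqxx //.
by rewrite /minn; case: (label u < label v); rewrite eqxx ?orbT.
Qed.

(** Unless [e] is the additional arc, before which nothing starts, some component descends along
    [e], so one of the shared factors starts exactly at its source level. If [e'] started earlier,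
    both factors would. *)
Lemma same_factors_source_level e e' :
  left_factor e = left_factor e' -> right_factor e = right_factor e' ->
  level_lt (source_level e') (source_level e) = false.
Proof.
move=> eql eqr; apply/negP => /source_level_factors[].
rewrite -eql -eqr; case: e {eql eqr} => [[q b]|//] /=.
have /orP[at1 + _|at2 _] := at_apply_label (internal_terminal q);
  by rewrite source_level_factor_at //= ltnn.
Qed.

Lemma factors_inj : injective (fun e => (left_factor e, right_factor e)).
Proof.
move=> e e' [eql eqr].
have := same_factors_source_level eql eqr.
have := same_factors_source_level (esym eql) (esym eqr).
case: e e' eql eqr => [[q b]|] [[q' b']|] //= eql eqr.
rewrite /source_level /= => /negbT; rewrite -leqNgt => le1 /negbT.
rewrite -leqNgt => le2.
have eq_label : apply_label (val q') = apply_label (val q).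
  by apply/eqP; rewrite eqn_leq le1.
have [e1 e2] := internal_entered q; have [] := internal_entered q'.
rewrite eq_label => e1' e2'; rewrite !eq_label in eql eqr.
have [p1 b1] := factor_inj e1 e1' eql; have [p2 b2] := factor_inj e2 e2' eqr.
(* The branch is read off from a component that descends. *)
have -> : b = b' by have /orP[/b1|/b2] := at_apply_label (internal_terminal q).
congr (Some (_, _)); apply: val_inj.
by rewrite [LHS]surjective_pairing [RHS]surjective_pairing p1 p2.
Qed.

End ApplyArcs.

(** * Weights around a fixed level [j] *)

Section Weights.
Variables i j : nat.
Hypothesis i_gt0 : 0 < i.
Hypothesis i_le2 : i <= 2.

Definition band (l : level) : bool :=
  level_lt (Level j) l && level_lt l (Level (j + i)).

(* The band is at most one level thick, since [i <= 2]. *)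
Lemma band_antichain l m : band l -> level_lt l m -> level_lt m (Level (j + i)) = false.
Proof.
case: l m => [|k|] [|n|] //=; rewrite /band /= => /andP[jk _] kn.
by apply/negbTE; rewrite -leqNgt; apply: leq_trans (leq_ltn_trans jk kn);
  rewrite -addn2 leq_add2l.
Qed.

Lemma level_lt_band_top l : level_lt l (Level j.+1) -> level_lt l (Level (j + i)).
Proof. by case: l => //= n /leq_trans; apply; rewrite -addn1 leq_add2l. Qed.

(** * A cut at least as large as the sum of the weights *)

Section OneBdd.
Variable h : bdd.
Implicit Types (x : node h) (a : bdd_arc h).

Definition early_degree x : nat := #|[set a | enters (Level j.+1) x a]|.

(* The largest number of arcs that a cut around level [j] can charge to [x]:
   a node of the band has two outgoing arcs and may lie on either side. *)
Definition weight x : nat :=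
  if level_lt (Level j) (bdd_level x) then
    if level_lt (bdd_level x) (Level (j + i)) then maxn (early_degree x) 2
    else early_degree x
  else 0.

(* A crossing arc is charged to its target if it starts at or above level [j],
   and to its source, which then is in the band, otherwise. *)
Definition charged a : node h :=
  if a is Some (v, b) then
    if level_lt (source_level a) (Level j.+1) then child b v else inl v
  else Defs.root h.

Lemma charged_early x a : enters (Level j.+1) x a -> charged a = x.
Proof.
by case: a => [[v b]|] /andP[/eqP[]] /= <- // ->.
Qed.

(** A band node with fewer than two early arcs gains by moving to the source side, where its two
    outgoing arcs replace them. *)
Definition best_source : {set option (node h)} :=
  [set z in bdd_vertices h | level_lt (bdd_dag_level z) (Level j.+1) ||
     (if z is Some x then
        level_lt (bdd_level x) (Level (j + i)) && (early_degree x < 2)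
      else false)].

Definition best_target : {set option (node h)} := bdd_vertices h :\: best_source.

Lemma best_level_cut : is_level_cut (G := bdd_dag h) i best_source best_target.
Proof.
split; first split.
- have sV : best_source \subset bdd_vertices h.
    by apply/subsetP=> z; rewrite inE => /andP[].
  by rewrite /best_target setDE setUIr setUCr setIT (setUidPr sV).
- by rewrite -setI_eq0 setIDA; apply/eqP/setP=> z;
    rewrite in_setD in_setI in_set0; case: (z \in best_source).
exists j; split=> z; rewrite !inE.
  case/andP=> _ /orP[/level_lt_band_top //|].
  by case: z => //= x /andP[].
case/andP=> + zV; rewrite zV /= negb_or => /andP[+ _].
by rewrite level_ltS negbK.
Qed.

Definition best_cut : {set bdd_arc h} :=
  [set a | (bdd_source a \in best_source) && (bdd_target a \in best_target)].

Lemma weight_le_charged x : weight x <= #|[set a in best_cut | charged a == x]|.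
Proof.
rewrite /weight; case: ifP => // jx.
have xNearly : level_lt (bdd_level x) (Level j.+1) = false.
  by rewrite level_ltS jx.
(* The condition keeps [x] on the target side, where all its early arcs cross. *)
have incoming : ~~ (level_lt (bdd_level x) (Level (j + i)) && (early_degree x < 2)) ->
    early_degree x <= #|[set a in best_cut | charged a == x]|.
  move=> xT; apply/subset_leq_card/subsetP=> a; rewrite inE => ax.
  rewrite !inE (charged_early ax) eqxx andbT.
  case/andP: ax => /eqP ta sa.
  have := bdd_source_in a; have := bdd_target_in a; rewrite !inE => -> ->.
  by rewrite andbT; move: sa; rewrite /source_level => -> /=; rewrite ta /= xNearly.
case: ifP => [xi|xi]; last by apply: incoming; rewrite xi.
have [d2|d2] := leqP 2 (early_degree x).
  by apply: incoming; rewrite ltnNge d2 andbF.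
case: x jx xNearly {incoming} xi d2 => [v|//].
move=> jv vNearly vi d2.
(* Here [v] is on the source side, and its arcs lead past the band, hence to the target side. *)
have out b : Some (v, b) \in [set a in best_cut | charged a == inl v].
  have lt_child := bdd_ordered b v.
  have sS : bdd_source (Some (v, b)) \in best_source.
    by rewrite in_set bdd_source_in; apply/orP; right; apply/andP; split.
  have tT : bdd_target (Some (v, b)) \in best_target.
    rewrite in_setD bdd_target_in andbT in_set bdd_target_in /=.
    rewrite (band_antichain _ lt_child) ?orbF; last by rewrite /band jv vi.
    by rewrite level_ltS negbK; apply: level_lt_trans lt_child.
  rewrite in_set; apply/andP; split; first by rewrite in_set; apply/andP.
  by move: vNearly; rewrite /charged /source_level /= => ->.
have /subset_leq_card : [set Some (v, true); Some (v, false)] \subset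
    [set a in best_cut | charged a == inl v].
  by apply/subsetP=> a /set2P[] ->; apply: out.
by rewrite cards2; case: eqP.
Qed.

Lemma sum_weight_le_max_cut : \sum_(x : node h) weight x <= max_bdd_cut i h.
Proof.
apply: leq_trans (leq_bigmax_cond
  (F := fun c => @cut_size (bdd_dag h) c.1 c.2) (best_source, best_target) _).
  rewrite /cut_size /= -/best_cut -sum1_card (partition_big charged predT) //=.
  apply: leq_sum => x _; rewrite sum1dep_card.
  by have := weight_le_charged x; congr (_ <= _); apply: eq_card=> a; rewrite !inE.
by apply/asboolP; apply: best_level_cut.
Qed.

End OneBdd.

(** * Upper bound on the cuts of the product *)

Section ApplyCut.
Variables (op : bool -> bool -> bool) (f g : bdd).
Variables S T : {set option (node (apply op f g))}.
Hypothesis ST_disjoint : [disjoint S & T].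
Hypothesis S_level : forall s, s \in S -> level_lt (bdd_dag_level s) (Level (j + i)).
Hypothesis T_level : forall t, t \in T -> level_lt (Level j) (bdd_dag_level t).
Implicit Types (p : apply_pair f g) (e : bdd_arc (apply op f g)).

(* As [charged], but distinguishing the pairs of terminals that [apply_node]
   merges. *)
Definition charged_pair e : apply_pair f g :=
  if e is Some (q, b) then
    if level_lt (source_level e) (Level j.+1) then apply_child b (val q) else val q
  else apply_root f g.

Definition apply_cut : {set bdd_arc (apply op f g)} :=
  [set e | (bdd_source e \in S) && (bdd_target e \in T)].

Definition charged_to p : {set bdd_arc (apply op f g)} :=
  [set e in apply_cut | charged_pair e == p].

Lemma charged_pair_early e :
  level_lt (source_level e) (Level j.+1) -> charged_pair e = arc_pair e.
Proof. by case: e => [[q b]|] //= ->. Qed.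

Lemma charged_to_level p e :
  e \in charged_to p -> level_lt (Level j) (pair_level p).
Proof.
rewrite !inE => /andP[/andP[_ eT] /eqP <-].
have [early|late] := boolP (level_lt (source_level e) (Level j.+1)).
  rewrite charged_pair_early // -(level_apply_node op (arc_pair_reachable e)).
  by have := T_level eT; rewrite target_arc_pair.
case: e late {eT} => [[q b]|//] late; rewrite /charged_pair (negbTE late).
by rewrite (pair_level_label (internal_terminal q)); rewrite level_ltS negbK in late.
Qed.

Lemma early_degree_le_weight (h : bdd) (x : node h) :
  level_lt (Level j) (bdd_level x) -> early_degree x <= weight x.
Proof. by rewrite /weight => ->; case: ifP; rewrite ?leq_maxl. Qed.

(** The factors of an early arc are early and enter the two components, so [factors_inj] embeds the
    charged arcs into pairs of early arcs. *)
Lemma card_charged_early p :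
  level_lt (Level j) (pair_level p) ->
  (forall e, e \in charged_to p -> level_lt (source_level e) (Level j.+1)) ->
  #|charged_to p| <= weight p.1 * weight p.2.
Proof.
rewrite level_lt_min => /andP[j1 j2] early.
apply: (@leq_trans (early_degree p.1 * early_degree p.2)); last first.
  by apply: leq_mul; apply: early_degree_le_weight.
rewrite -cardsX -(card_imset _ (@factors_inj op f g)).
apply/subset_leq_card/subsetP=> ac /imsetP[e ep ->{ac}].
have ee := early e ep; have [l1 l2] := source_level_factors ee.
have [t1 t2] := target_factors e.
move: ep; rewrite !inE charged_pair_early // => /andP[_ /eqP ep].
by rewrite /enters t1 t2 ep !eqxx l1 l2.
Qed.

(** A late arc charged to [p] puts its source in [S], so no early arc into that node crosses and
    only its two outgoing arcs can be charged. The product of weights is at least 2, as one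
    component lies in the band and the other has positive weight. *)
Lemma card_charged_late p e : e \in charged_to p ->
  ~~ level_lt (source_level e) (Level j.+1) ->
  #|charged_to p| <= weight p.1 * weight p.2.
Proof.
move=> ep late; have jp := charged_to_level ep.
case: e ep late => [[q b]|//] ep late.
move: ep; rewrite !inE /charged_pair (negbTE late) => /andP[/andP[qS _] /eqP qp].
have tp := internal_terminal q; rewrite qp in tp.
have pi : level_lt (pair_level p) (Level (j + i)).
  by rewrite (pair_level_label tp) -qp; apply: (S_level qS).
have all_late e : e \in charged_to p -> e \in [set Some (q, true); Some (q, false)].
  rewrite !inE => /andP[/andP[_ eT] /eqP].
  have [early|late'] := boolP (level_lt (source_level e) (Level j.+1)).
    rewrite charged_pair_early // => ep.
    move: eT; rewrite target_arc_pair ep -qp /apply_node valK => qT.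
    by have := disjointFr ST_disjoint qS; rewrite [X in X = _]qT.
  case: e late' {eT} => [[q' b']|//] late'; rewrite /charged_pair (negbTE late').
  by rewrite -qp => /val_inj ->; case: b' {late'}; rewrite eqxx ?orbT.
apply: (@leq_trans 2).
  apply: leq_trans (subset_leq_card (introT subsetP all_late)) _.
  by rewrite cards2; case: eqP.
have rp : reachable p by rewrite -qp; apply: internal_reachable.
(* Two levels of the band are never strictly ordered, so an arc starting before [pair_level p]
   starts at level [j] at the latest. *)
have early_entry (h : bdd) (x : node h) :
    (exists a, enters (pair_level p) x a) -> 0 < early_degree x.
  case=> a /andP[ta sa]; apply/card_gt0P; exists a; rewrite inE /enters ta /=.
  apply: contraT; rewrite level_ltS negbK => ja.
  have ba : band (source_level a) by rewrite /band ja (level_lt_trans sa pi).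
  by move: pi; rewrite (band_antichain ba sa).
have [/early_entry d1 /early_entry d2] := reachable_entered op rp.
move: jp; rewrite level_lt_min => /andP[j1 j2].
have w1 := leq_trans d1 (early_degree_le_weight j1).
have w2 := leq_trans d2 (early_degree_le_weight j2).
have in_band (h : bdd) (x : node h) : level_lt (Level j) (bdd_level x) ->
    level_lt (bdd_level x) (Level (j + i)) -> 2 <= weight x.
  by rewrite /weight => -> ->; apply: leq_maxr.
move: pi; rewrite level_min_lt => /orP[/(in_band _ _ j1) b1|/(in_band _ _ j2) b2].
  exact: (leq_mul b1 w2).
exact: (leq_mul w1 b2).
Qed.

Lemma card_charged_to p : #|charged_to p| <= weight p.1 * weight p.2.
Proof.
have [->|[e ep]] := set_0Vmem (charged_to p); first by rewrite cards0.
have [/existsP[e' /andP[]]|/existsPn early] :=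
  boolP [exists e, (e \in charged_to p) && ~~ level_lt (source_level e) (Level j.+1)].
  exact: card_charged_late.
apply: card_charged_early (charged_to_level ep) _ => e' e'p.
by have := early e'; rewrite e'p negbK.
Qed.

Lemma card_apply_cut :
  #|apply_cut| <= (\sum_(x : node f) weight x) * \sum_(y : node g) weight y.
Proof.
rewrite big_distrlr pair_bigA /= -sum1_card (partition_big charged_pair predT) //=.
apply: leq_sum => p _; rewrite sum1dep_card; apply: leq_trans (card_charged_to p).
by apply/subset_leq_card/subsetP=> e; rewrite !inE.
Qed.

End ApplyCut.
End Weights.

Theorem theorem2 (op : bool -> bool -> bool) (f g : bdd) (i : nat)
    (hi : i = 1 \/ i = 2) :
  max_bdd_cut i (apply op f g) <= max_bdd_cut i f * max_bdd_cut i g.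
Proof.
have [i_gt0 i_le2] : 0 < i /\ i <= 2 by case: hi => ->.
apply/bigmax_leqP=> -[S T] /asboolP[[_ dST] [j [S_level T_level]]].
(* The [j] of the given cut serves for the weights in both [f] and [g]. *)
apply: leq_trans (card_apply_cut i_le2 dST S_level T_level) _.
by apply: leq_mul; apply: sum_weight_le_max_cut.
Qed.
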